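(* $\mathsf{PST}_{\mathbb{N}^{\mathbb{N}}}<_{\mathrm{W}}\mathsf{PK}_{\mathbb{N}^{\mathbb{N}}}$, and $\mathsf{PK}_{\mathbb{N}^{\mathbb{N}}}$ and $\mathsf{C}_{\mathbb{N}^{\mathbb{N}}}$ are Weihrauch incomparable.
   Context: A represented space is a set $X$ with a partial surjection $\delta_X:\subseteq\mathbb{N}^{\mathbb{N}}\to X$; $p$ is a name of $x$ if $\delta_X(p)=x$. A problem is a partial multi-valued function $f:\subseteq X\rightrightarrows Y$ between represented spaces. $f\le_{\mathrm{W}} g$ (Weihrauch reducibility) means that there are computable partial maps $\Phi,\Psi:\subseteq\mathbb{N}^{\mathbb{N}}\to\mathbb{N}^{\mathbb{N}}$ such that for every name $p$ of some $x\in\mathrm{dom}(f)$, $\Phi(p)$ is a name of some $y\in\mathrm{dom}(g)$, and for every name $q$ of an element of $g(y)$, $\Psi(p*q)$ is a name of an element of $f(x)$, where $p*q$ is the interleaving of $p$ and $q$. $f<_{\mathrm{W}}g$ means $f\le_{\mathrm{W}}g$ and $g\not\le_{\mathrm{W}}f$; incomparable means $f\not\le_{\mathrm{W}}g$ and $g\not\le_{\mathrm{W}}f$. A tree is a nonempty subset $T$ of $\mathbb{N}^{<\mathbb{N}}$ closed under initial segments; $[T]$ is its set of infinite paths. $\mathcal{A}(\mathbb{N}^{\mathbb{N}})$ is the space of closed subsets of Baire space, a name of $C$ being (the characteristic function of) a tree $T$ with $[T]=C$; this is equivalent to the usual negative representation. $\mathbb{N}^{\mathbb{N}}$ is represented by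 the identity. A closed set is perfect if it has no isolated points; the perfect kernel of a closed set $A$ is the unique perfect $P\subseteq A$ with $A\setminus P$ countable. $\mathsf{PST}_{\mathbb{N}^{\mathbb{N}}}:\subseteq\mathcal{A}(\mathbb{N}^{\mathbb{N}})\rightrightarrows\mathcal{A}(\mathbb{N}^{\mathbb{N}})$ has domain $\{A:|A|>\aleph_0\}$ and maps $A$ to the set of all nonempty perfect $P\subseteq A$. $\mathsf{PK}_{\mathbb{N}^{\mathbb{N}}}:\mathcal{A}(\mathbb{N}^{\mathbb{N}})\to\mathcal{A}(\mathbb{N}^{\mathbb{N}})$ maps a closed set to its perfect kernel. $\mathsf{C}_{\mathbb{N}^{\mathbb{N}}}:\subseteq\mathcal{A}(\mathbb{N}^{\mathbb{N}})\rightrightarrows\mathbb{N}^{\mathbb{N}}$ has domain the nonempty closed sets and $\mathsf{C}_{\mathbb{N}^{\mathbb{N}}}(A)=A$. *)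

(* Defs.v *)
From mathcomp Require Import all_boot all_order.
From mathcomp Require Import mathcomp_extra boolp classical_sets functions cardinality topology.

Set Implicit Arguments.
Unset Strict Implicit.
Unset Printing Implicit Defensive.

Local Open Scope classical_set_scope.

Notation baire := {ptws nat -> nat}.

(* Mu-recursive functions with an oracle.  Arities are not tracked: a code    *)
(* has no value on too few arguments, and surplus arguments are ignored.      *)
Inductive code : Type :=
  | Zero
  | Succ
  | Proj of nat
  | Oracle
  | Comp of code & seq code
  | Rec of code & code
  | Mu of code.

Inductive eval (p : baire) : code -> seq nat -> nat -> Prop :=
  | EvalZero v : eval p Zero v 0
  | EvalSucc n v : eval p Succ (n :: v) n.+1
  | EvalProj i v : i < size v -> eval p (Proj i) v (nth 0 v i)
  | EvalOracle n v : eval p Oracle (n :: v) (p n)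
  | EvalComp f gs v w y : size w = size gs ->
      (forall i, i < size gs -> eval p (nth Zero gs i) v (nth 0 w i)) ->
      eval p f w y -> eval p (Comp f gs) v y
  | EvalRec0 f g v y : eval p f v y -> eval p (Rec f g) (0 :: v) y
  | EvalRecS f g n v z y : eval p (Rec f g) (n :: v) z ->
      eval p g [:: n, z & v] y -> eval p (Rec f g) (n.+1 :: v) y
  | EvalMu f v n (w : nat -> nat) :
      (forall m, m < n -> eval p f (m :: v) (w m).+1) ->
      eval p f (n :: v) 0 -> eval p (Mu f) v n.

Lemma eval_fun p c v y z : eval p c v y -> eval p c v z -> y = z.
Proof.
move=> h; elim: h z => {c v y}.
- by move=> v z h; inversion h.
- by move=> n v z h; inversion h.
- by move=> i v _ z h; inversion h.
- by move=> n v z h; inversion h.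
- move=> f gs v w y sw _ IHg _ IHf z h; inversion h; subst.
  suff E : w = w0 by apply: IHf; rewrite E.
  apply: (@eq_from_nth _ 0) => [|i]; first by rewrite sw.
  by rewrite sw => i_lt; apply: IHg => //; auto.
- by move=> f g v y _ IH z h; inversion h; subst; apply: IH.
- move=> f g n v z y _ IH1 _ IH2 t h; inversion h as [| | | | | |? ? ? ? z' ? h1 h2|]; subst.
  by apply: IH2; rewrite (IH1 _ h1).
- move=> f v n w _ IH1 _ IH2 z h; inversion h as [| | | | | | |? ? ? w' h1 h2]; subst.
  case: (ltngtP n z) => // [lt|gt].
    by have := IH2 _ (h1 _ lt).
  by have := IH1 _ gt _ h2.
Qed.

(* A partial map is computable when some machine produces, on every oracle in *)
(* its domain, the values of the image; outside the domain nothing is asked.  *)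
Definition computable (F : baire -> option baire) : Prop :=
  exists c : code, forall p q, F p = Some q -> forall n, eval p c [:: n] (q n).

(* [name p x] is the graph of the partial surjection from names to points. *)
Record repr_space : Type := ReprSpace {
  point :> Type;
  name : baire -> point -> Prop;
  name_functional : forall p x y, name p x -> name p y -> x = y;
  name_surjective : forall x, exists p, name p x }.

(* A partial multi-valued function is given by its graph; its domain is the   *)
(* set of the points that have at least one value.                            *)
Definition problem (X Y : repr_space) : Type := X -> set Y.

Definition dom (X Y : repr_space) (f : problem X Y) : set X :=
  [set x | f x !=set0].

Definition interleave (p q : baire) : baire :=
  fun n => if odd n then q n./2 else p n./2.

Definition weihrauch_le (X Y Z W : repr_space)
    (f : problem X Y) (g : problem Z W) : Prop :=
  exists Phi Psi : baire -> option baire,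
    [/\ computable Phi, computable Psi &
      forall p x, name p x -> dom f x ->
      exists p' z, [/\ Phi p = Some p', name p' z, dom g z &
        forall q w, name q w -> g z w ->
        exists r y, [/\ Psi (interleave p q) = Some r, name r y & f x y]]].

Definition weihrauch_lt (X Y Z W : repr_space)
    (f : problem X Y) (g : problem Z W) : Prop :=
  weihrauch_le f g /\ ~ weihrauch_le g f.

Definition weihrauch_incomparable (X Y Z W : repr_space)
    (f : problem X Y) (g : problem Z W) : Prop :=
  ~ weihrauch_le f g /\ ~ weihrauch_le g f.

Definition is_tree (T : set (seq nat)) : Prop :=
  T !=set0 /\ forall s t, prefix s t -> T t -> T s.

Definition paths (T : set (seq nat)) : set baire :=
  [set x | forall n, T (mkseq x n)].

(* Finite sequences are numbered by the computable bijection [CodeSeq.code].  *)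
Definition tree_name (p : baire) (A : set baire) : Prop :=
  exists T : set (seq nat),
    [/\ is_tree T, forall s, p (CodeSeq.code s) = `[< T s >] & paths T = A].

Record closed_set : Type := ClosedSet {
  set_of_closed :> set baire;
  closed_set_closed : closed set_of_closed }.

Lemma closed_set_inj (A B : closed_set) : A = B :> set baire -> A = B.
Proof.
by case: A B => [A hA] [B hB] /= AB; subst B; congr ClosedSet; exact: Prop_irrelevance.
Qed.

Definition cylinder (s : seq nat) : set baire :=
  [set x | mkseq x (size s) = s].

Lemma cylinderE (x y : baire) n :
  cylinder (mkseq x n) y <-> forall i, i < n -> y i = x i.
Proof.
rewrite /cylinder /= size_mkseq; split=> [E i i_lt|E].
  by rewrite -(nth_mkseq 0 y i_lt) E nth_mkseq.
apply: (@eq_from_nth _ 0); rewrite !size_mkseq // => i i_lt.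
by rewrite !nth_mkseq // E.
Qed.

Lemma nbhs_baireP (x : baire) (U : set baire) :
  nbhs x U <-> exists n, cylinder (mkseq x n) `<=` U.
Proof.
split; last first.
  move=> [n nU]; apply: (filterS nU); elim: n {nU} => [|n IH].
    have T0 : setT `<=` cylinder (mkseq x 0) by move=> y _; apply/cylinderE.
    exact: (filterS T0 filterT).
  have /(_ x) pc := @proj_continuous _ (fun _ : nat => nat) n.
  have nx : nbhs (proj n x) [set x n] by apply/principal_filterP.
  apply: filterS2 (IH) (pc _ nx) => y /cylinderE yn /= yxn; apply/cylinderE => i.
  by rewrite ltnS leq_eqVlt => /orP[/eqP ->|/yn].
pose F := filter_from [set: nat] (fun n => cylinder (mkseq x n)).
suff: F --> x by move=> Fx /Fx [n _ nU]; exists n.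
have FF : Filter F.
  apply: filter_from_filter; first by exists 0.
  move=> m n _ _; exists (maxn m n) => // y /cylinderE E.
  by split; apply/cylinderE => i i_lt; apply: E; rewrite leq_max i_lt ?orbT.
apply/cvg_sup => i V [V' [[W oW <-] /= Wx] WV].
exists i.+1 => // y /cylinderE E; apply: WV => /=.
by rewrite /= E.
Qed.

Lemma closed_paths (T : set (seq nat)) : closed (paths T).
Proof.
move=> x Tx n; have /Tx [y [Ty /cylinderE yx]] : nbhs x (cylinder (mkseq x n)).
  by apply/nbhs_baireP; exists n.
suff -> : mkseq x n = mkseq y n by [].
apply: (@eq_from_nth _ 0); rewrite !size_mkseq // => i i_lt.
by rewrite !nth_mkseq // yx.
Qed.

Lemma tree_name_functional p (A B : closed_set) :
  tree_name p A -> tree_name p B -> A = B.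
Proof.
move=> [T [_ pT TA]] [S [_ pS SB]]; apply: closed_set_inj; rewrite -TA -SB.
congr paths; apply/funext => s; apply/propext.
by have := pS s; rewrite pT; case: asboolP; case: asboolP.
Qed.

Lemma tree_name_surjective (A : closed_set) : exists p, tree_name p A.
Proof.
pose T := [set s | s = [::] \/ exists2 x, set_of_closed A x & exists n, s = mkseq x n].
exists (fun n => `[< T (CodeSeq.decode n) >] : nat), T; split.
- split; first by exists [::]; left.
  move=> s t; rewrite prefixE => /eqP <- [->|[x Ax [n ->]]]; first by left.
  by right; exists x => //; exists (minn (size s) n); rewrite /mkseq -map_take take_iota.
- by move=> s; rewrite CodeSeq.codeK.
- apply/seteqP; split=> [x xT|x Ax n]; last by right; exists x => //; exists n.
  have cA : closure (A : set baire) `<=` A by exact: closed_set_closed.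
  apply: cA => U /nbhs_baireP[n nU].
  have [//|[y Ay [m E]]] := xT n.+1.
  exists y; split=> //; apply: nU; apply/cylinderE => i i_lt.
  have mn : m = n.+1 by rewrite -(size_mkseq y m) -E size_mkseq.
  have i_ltS : i < n.+1 by rewrite ltnS ltnW.
  by move/(congr1 (nth 0 ^~ i)): E; rewrite mn !nth_mkseq.
Qed.

Definition closed_space : repr_space :=
  ReprSpace tree_name_functional tree_name_surjective.

Definition baire_space : repr_space :=
  @ReprSpace baire (fun p x => p = x)
    (fun p x y px py => etrans (esym px) py) (fun x => ex_intro _ x erefl).

(* [perfect_set], from the library, means closed and equal to its set of limit *)
(* points; for a closed set this says that there are no isolated points        *)
(* ([perfectP]).  The empty set is perfect.                                    *)
Definition perfect_kernel (A P : set baire) : Prop :=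
  [/\ perfect_set P, P `<=` A & countable (A `\` P)].

Definition PST : problem closed_space closed_space :=
  fun A => [set P | ~ countable (A : set baire) /\
    [/\ (P : set baire) !=set0, perfect_set (P : set baire) &
        (P : set baire) `<=` A]].

(* Total ([dom_PK]) and single-valued ([perfect_kernel_unique]). *)
Definition PK : problem closed_space closed_space :=
  fun A => [set P | perfect_kernel A P].

Definition C_Baire : problem closed_space baire_space :=
  fun A => set_of_closed A.

Lemma cylinder_self (x : baire) n : cylinder (mkseq x n) x.
Proof. exact/cylinderE. Qed.

Lemma perfect_kernel_exists (A : set baire) :
  closed A -> exists P, perfect_kernel A P.
Proof.
move=> cA.
pose P := [set x | A x /\ forall n, ~ countable (A `&` cylinder (mkseq x n))].
have PA : P `<=` A by move=> x [].
have AP : countable (A `\` P).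
  pose D := [set s | countable (A `&` cylinder s)].
  apply: (@sub_countable _ _ _ (\bigcup_(s in D) (A `&` cylinder s))).
    apply: subset_card_le => x [Ax nPx].
    have [n xn] : exists n, countable (A `&` cylinder (mkseq x n)).
      apply: contrapT => H; apply: nPx; split=> // n xn; apply: H.
      by exists n.
    by exists (mkseq x n) => //; split=> //; exact: cylinder_self.
  by apply: bigcup_countable.
exists P; split=> //; apply/perfectP; split.
  move=> x xP; split.
    by apply: cA => U /xP [y [[Ay _] Uy]]; exists y.
  move=> n xn; have [|y [[_ Py] /cylinderE yx]] := xP (cylinder (mkseq x n)).
    by apply/nbhs_baireP; exists n.
  apply: (Py n); suff <- : mkseq x n = mkseq y n by [].
  by apply: (@eq_from_nth _ 0) => [|i]; rewrite !size_mkseq // => i_lt;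
     rewrite !nth_mkseq // yx.
apply/seteqP; split=> // x [/set_mem [Ax Px] [V /nbhs_baireP[n nV] VP]].
apply: (Px n); apply: (@sub_countable _ _ _ ((A `\` P) `|` [set x])).
  apply: subset_card_le => y [Ay yn].
  have [Py|nPy] := pselect (P y); last by left.
  by right; rewrite -VP; split=> //; exact: nV.
rewrite -bigcup2E; apply: bigcup_countable => // -[|[|k]] _ //=.
Qed.

Lemma perfect_set_uncountable (P : set baire) (x : baire) n :
  perfect_set P -> P x -> ~ countable (P `&` cylinder (mkseq x n)).
Proof.
move=> [cP lP] Px /countable_injP [f f_inj].
have sep (u v : baire) : u <> v -> exists m, ~ cylinder (mkseq u m) v.
  move=> uv; apply: contrapT => H; apply: uv; apply/funext => i.
  have /cylinderE E : cylinder (mkseq u i.+1) v.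
    by apply: contrapT => h; apply: H; exists i.+1.
  by rewrite E.
have mono (u : baire) k m :
    k <= m -> cylinder (mkseq u m) `<=` cylinder (mkseq u k).
  move=> km v /cylinderE E; apply/cylinderE => i i_lt.
  by apply: E; apply: leq_trans km.
have step (k : nat) (s : baire * nat) : exists t : baire * nat,
    P s.1 -> [/\ P t.1, s.2 < t.2, cylinder (mkseq s.1 s.2) t.1 &
      forall y, cylinder (mkseq t.1 t.2) y ->
        (P `&` cylinder (mkseq x n)) y -> f y <> k].
  case: s => u a /=.
  have [Pu|nPu] := pselect (P u); last by exists (u, a) => /nPu.
  have [[y [[Py yx] fy]]|H] :=
      pselect (exists y, (P `&` cylinder (mkseq x n)) y /\ f y = k); last first.
    exists (u, a.+1) => _; split=> //=; first exact: cylinder_self.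
    by move=> y _ By fy; apply: H; exists y.
  have [v [Pv vu vy]] : exists v, [/\ P v, cylinder (mkseq u a) v & v <> y].
    have [uy|uy] := pselect (u = y); last first.
      by exists u; split=> //; exact: cylinder_self.
    have : limit_point P u by rewrite lP.
    have nu : nbhs u (cylinder (mkseq u a)) by apply/nbhs_baireP; exists a.
    move=> /(_ _ nu) [v [/eqP vu Pv uv]].
    by exists v; split=> //; rewrite -uy.
  have [m vm] := sep _ _ vy.
  exists (v, maxn m a.+1) => _; split=> //=; first by rewrite leq_max leqnn orbT.
  move=> z zv Bz fz; apply: vm.
  suff <- : z = y by apply: mono zv; rewrite leq_maxl.
  by apply: f_inj; rewrite ?inE ?fz ?fy.
have [g gP] : exists g : nat -> baire * nat -> baire * nat, forall k s,
    P s.1 -> [/\ P (g k s).1, s.2 < (g k s).2, cylinder (mkseq s.1 s.2) (g k s).1 &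
      forall y, cylinder (mkseq (g k s).1 (g k s).2) y ->
        (P `&` cylinder (mkseq x n)) y -> f y <> k].
  exists (fun k s => projT1 (cid (step k s))) => k s.
  by case: cid.
pose fix t k : baire * nat := if k is k'.+1 then g k' (t k') else (x, n).
have Pt k : P (t k).1 by elim: k => //= k IH; case: (gP k _ IH).
have tlt k : (t k).2 < (t k.+1).2 by case: (gP k _ (Pt k)).
have tge k : k <= (t k).2 by elim: k => // k IH; apply: leq_ltn_trans (tlt k).
have tmono k l : k <= l -> (t k).2 <= (t l).2.
  elim: l => [|l IH]; first by rewrite leqn0 => /eqP ->.
  rewrite leq_eqVlt => /orP[/eqP -> //|]; rewrite ltnS => /IH h.
  exact: leq_trans h (ltnW (tlt l)).
have tagree k l i : k <= l -> i < (t k).2 -> (t l).1 i = (t k).1 i.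
  move=> + i_lt; elim: l => [|l IH]; first by rewrite leqn0 => /eqP ->.
  rewrite leq_eqVlt => /orP[/eqP -> //|]; rewrite ltnS => kl.
  rewrite -(IH kl); case: (gP l _ (Pt l)) => _ _ /cylinderE + _.
  by apply; apply: leq_trans (tmono _ _ kl).
pose z : baire := fun i => (t i.+1).1 i.
have zt k : cylinder (mkseq (t k).1 (t k).2) z.
  apply/cylinderE => i i_lt; rewrite /z.
  have [ki|ik] := leqP k i.+1; first exact: tagree.
  by rewrite (tagree _ _ _ (ltnW ik)) ?tge.
have Pz : P z.
  apply: (cP : closure P `<=` P) => U /nbhs_baireP[m mU].
  exists (t m).1; split=> //; apply: mU; apply/cylinderE => i i_lt.
  by apply: esym; move/cylinderE: (zt m); apply; exact: leq_trans i_lt (tge m).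
have [_ _ _ /(_ z)] := gP (f z) _ (Pt (f z)).
by apply=> //; [exact: (zt (f z).+1)|split=> //; exact: (zt 0)].
Qed.

Lemma perfect_kernel_unique (A P Q : set baire) :
  perfect_kernel A P -> perfect_kernel A Q -> P = Q.
Proof.
suff incl P' Q' : perfect_kernel A P' -> perfect_kernel A Q' -> P' `<=` Q'.
  by move=> hP hQ; apply/seteqP; split; exact: incl.
move=> [pP PA _] [[cQ _] _ AQ] x Px; apply: contrapT => nQx.
have [n nQ] : exists n, cylinder (mkseq x n) `<=` ~` Q'.
  apply/nbhs_baireP; apply: open_nbhs_nbhs; split=> //.
  exact: closed_openC.
apply: (perfect_set_uncountable (n := n) pP Px).
apply: sub_countable AQ; apply: subset_card_le => y [Py yn].
by split; [exact: PA|exact: nQ].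
Qed.

Lemma dom_PK : dom PK = setT.
Proof.
apply/seteqP; split=> // A _.
have [P kP] := perfect_kernel_exists (@closed_set_closed A).
by have [[cP _] _ _] := kP; exists (ClosedSet cP).
Qed.

Lemma dom_PST : dom PST = [set A | ~ countable (A : set baire)].
Proof.
apply/seteqP; split=> [A [P []]|A /= uA] //.
have [P [pP PA AP]] := perfect_kernel_exists (@closed_set_closed A).
have [cP _] := pP; exists (ClosedSet cP); split=> //; split=> //=.
apply/set0P/negP => /eqP P0; apply: uA; apply: sub_countable AP.
by rewrite P0 setD0.
Qed.

Lemma dom_C_Baire : dom C_Baire = [set A | (A : set baire) !=set0].
Proof. by []. Qed.

(* Main.v *)
(* PST <= PK because the kernel of an uncountable closed set is a nonempty    *)
(* perfect subset of it.  The negative results already hold for continuous    *)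
(* reductions, and rest on one diagonalization: for analytic A and B there is *)
(* an oracle p coding two trees, the first with a path iff A p, the second    *)
(* iff B p (a closed set determines its tree so slowly that p can be defined  *)
(* by recursion).  In particular well-foundedness of trees is not analytic.   *)
(*                                                                            *)
(* For g = PST or C_Baire, the name of an instance has an analytic nonempty   *)
(* set of good solutions; for PST these are the pruned perfect subtrees.  A   *)
(* reduction of PK to g would therefore make it analytic that a point is      *)
(* outside the perfect kernel, hence that a tree is well-founded.             *)
(*                                                                            *)
(* If C_Baire were reducible to PK, one could use PK to decide, given trees S *)
(* and S', for one of rk S <= rk S' and rk S' < rk S that it has a witnessing *)
(* embedding.  That a prefix continues to a name of a perfect kernel is       *)
(* coanalytic, so that a given answer is obtainable from some kernel name is  *)
(* coanalytic as well, and diagonalizing against this gives a contradiction.  *)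
From mathcomp Require Import all_boot all_order.
From mathcomp Require Import boolp classical_sets cardinality topology.
Require Import Defs.

Set Implicit Arguments.
Unset Strict Implicit.
Unset Printing Implicit Defensive.

Local Open Scope classical_set_scope.

(** The diagonalization rests on a delay: the code of a sequence is at least its length, so trees
    whose nodes [s] are decided by the first [size s] entries of [p] can be coded in [p] itself
    ([fixed_point], [analytic_diagonal]). In [PK_not_le] it yields a set [X] that is nonempty
    exactly when some good solution shows zero to be outside the kernel of [fan X], that is, when
    [X] is empty. In [C_Baire_not_le_PK], [embeds_total] makes comparing two trees a solvable closed
    problem, [tree_name_modify] tells which prefixes continue to kernel names, and [embeds_path] and
    [embeds_cycle] refute the diagonal pair of trees. *)

(** * Locally constant functions (continuity into discrete sets), continuous maps and closed sets *)

Definition locally_constant (T : Type) (f : baire -> T) : Prop :=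
  forall r, nbhs r [set r' | f r' = f r].

Definition evens (r : baire) : baire := fun n => r n.*2.
Definition odds (r : baire) : baire := fun n => r n.*2.+1.
Definition tail (r : baire) : baire := fun n => r n.+1.

Lemma evens_interleave p q : evens (interleave p q) = p.
Proof. by apply/funext => n; rewrite /evens /interleave odd_double doubleK. Qed.

Lemma odds_interleave p q : odds (interleave p q) = q.
Proof.
by apply/funext => n; rewrite /odds /interleave /= odd_double /= uphalf_double.
Qed.

Lemma loc_cst T (x : T) : locally_constant (fun=> x).
Proof. by move=> r; exact: filterE. Qed.

Lemma loc_app T U (h : T -> U) f :
  locally_constant f -> locally_constant (fun r => h (f r)).
Proof. by move=> lf r; apply: filterS (lf r) => r' /= ->. Qed.

Lemma loc_app2 T U V (h : T -> U -> V) f g :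
  locally_constant f -> locally_constant g ->
  locally_constant (fun r => h (f r) (g r)).
Proof. by move=> lf lg r; apply: filterS2 (lf r) (lg r) => r' /= -> ->. Qed.

Lemma loc_dep T U (k : baire -> T) (f : T -> baire -> U) :
  locally_constant k -> (forall i, locally_constant (f i)) ->
  locally_constant (fun r => f (k r) r).
Proof. by move=> lk lf r; apply: filterS2 (lk r) (lf (k r) r) => r' /= -> ->. Qed.

Lemma loc_prefix n : locally_constant (fun r => mkseq r n).
Proof.
move=> r; apply/nbhs_baireP; exists n => r' /=.
by rewrite /cylinder /= size_mkseq.
Qed.

Lemma loc_finite T (f : baire -> T) n :
  (forall r r', mkseq r n = mkseq r' n -> f r = f r') -> locally_constant f.
Proof. by move=> fP r; apply: filterS (@loc_prefix n r) => r' /= /fP. Qed.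

Lemma loc_coord i : locally_constant (fun r => r i).
Proof.
apply: (@loc_finite _ _ i.+1) => r r' /(congr1 (nth 0 ^~ i)).
by rewrite !nth_mkseq.
Qed.

Lemma loc_comp T (f : baire -> T) (F : baire -> baire) :
  continuous F -> locally_constant f -> locally_constant (f \o F).
Proof. by move=> cF lf r; exact: cF (lf (F r)). Qed.

Lemma loc_eval (F : baire -> baire) (k : baire -> nat) :
  continuous F -> locally_constant k -> locally_constant (fun r => F r (k r)).
Proof.
move=> cF lk; apply: (@loc_dep _ _ k (fun i r => F r i)) => // i.
exact: (loc_comp cF (@loc_coord i)).
Qed.

Lemma continuous_coord (F : baire -> baire) :
  (forall i, locally_constant (fun r => F r i)) -> continuous F.
Proof.
move=> lF r U /nbhs_baireP [n nU].
suff : nbhs r [set r' | mkseq (F r') n = mkseq (F r) n].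
  by apply: filterS => r' /= E; apply: nU; rewrite /cylinder /= size_mkseq.
elim: n {nU} => [|n IH]; first exact: filterE.
by apply: filterS2 IH (lF n r) => r' /= E1 E2; rewrite !mkseqS E1 E2.
Qed.

Lemma loc_mkseq (F : baire -> baire) n :
  continuous F -> locally_constant (fun r => mkseq (F r) n).
Proof. by move=> cF; exact: (loc_comp cF (@loc_prefix n)). Qed.

Lemma continuous_reindex (g : nat -> nat) :
  continuous (fun r : baire => (fun n => r (g n)) : baire).
Proof. by apply: continuous_coord => i; exact: loc_coord. Qed.

Lemma continuous_evens : continuous evens.
Proof. exact: continuous_reindex. Qed.

Lemma continuous_odds : continuous odds.
Proof. exact: continuous_reindex. Qed.

Lemma continuous_tail : continuous tail.
Proof. exact: continuous_reindex. Qed.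

Lemma continuous_interleave (F G : baire -> baire) :
  continuous F -> continuous G -> continuous (fun r => interleave (F r) (G r)).
Proof.
move=> cF cG; apply: continuous_coord => i; rewrite /interleave.
by case: (odd i); apply: loc_eval => //; exact: loc_cst.
Qed.

Lemma continuous_compose (F G : baire -> baire) :
  continuous F -> continuous G -> continuous (fun r => F (G r)).
Proof. by move=> cF cG r; apply: continuous_comp; [exact: cG|exact: cF]. Qed.

Lemma closed_preimage (F : baire -> baire) (C : set baire) :
  continuous F -> closed C -> closed (fun r => C (F r)).
Proof.
move=> cF cC r Cr; apply: (cC) => U Ur.
have [r' [Cr' Ur']] := Cr _ (cF r U Ur).
by exists (F r').
Qed.

(** Closedness is local, and near each point the index [k r] is fixed. *)
Lemma closed_dep (T : Type) (k : baire -> T) (C : T -> set baire) :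
  locally_constant k -> (forall i, closed (C i)) -> closed (fun r => C (k r) r).
Proof.
move=> lk cC r Cr; apply: (cC (k r)) => U Ur.
have [r' [Cr' [/= E Ur']]] := Cr _ (filterI (lk r) Ur).
by exists r'; rewrite -E.
Qed.

Lemma closed_loc (C : set baire) : locally_constant C -> closed C.
Proof. by move=> lC r Cr; have [r' [Cr' /= <-]] := Cr _ (lC r). Qed.

Lemma closed_forall (T : Type) (C : T -> set baire) :
  (forall i, closed (C i)) -> closed (fun r => forall i, C i r).
Proof.
move=> cC r Cr i; apply: (cC i) => U /Cr [r' [Cr' Ur']].
by exists r'.
Qed.

(** * Analytic sets and their closure properties *)

(** Boldface: a projection of an arbitrary closed subset of the plane, with pairs coded by
    interleaving. *)
Definition analytic (A : set baire) : Prop :=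
  exists C : set baire,
    closed C /\ forall p, A p <-> exists y, C (interleave p y).

Lemma analytic_ext (A B : set baire) :
  (forall p, A p <-> B p) -> analytic A -> analytic B.
Proof.
by move=> AB [C [cC CA]]; exists C; split=> // p; rewrite -CA AB.
Qed.

Lemma analytic_preimage (F : baire -> baire) (A : set baire) :
  continuous F -> analytic A -> analytic (fun r => A (F r)).
Proof.
move=> cF [C [cC CA]]; exists (fun r => C (interleave (F (evens r)) (odds r))); split.
  apply: closed_preimage cC; apply: continuous_interleave continuous_odds.
  exact: continuous_compose continuous_evens.
move=> p; rewrite CA; split=> -[y Cy]; exists y;
  by move: Cy; rewrite evens_interleave odds_interleave.
Qed.

Lemma analytic_loc (A : set baire) : locally_constant A -> analytic A.
Proof.
move=> lA; exists (fun r => A (evens r)); split.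
  by apply: closed_preimage (closed_loc lA); exact: continuous_evens.
by move=> p; split=> [Ap|[y]]; [exists p|]; rewrite evens_interleave.
Qed.

Lemma analytic_ex (B : baire -> baire -> Prop) :
  analytic (fun r => B (evens r) (odds r)) -> analytic (fun p => exists q, B p q).
Proof.
move=> [C [cC BC]].
exists (fun r => C (interleave (interleave (evens r) (evens (odds r)))
                               (odds (odds r)))); split.
  apply: closed_preimage cC.
  have [ce co] := (continuous_evens, continuous_odds).
  by do 2?[apply: continuous_interleave => //]; exact: continuous_compose.
move=> p; split=> [[q]|[y]]; rewrite ?evens_interleave ?odds_interleave => H.
  have /BC [y Cy] : B (evens (interleave p q)) (odds (interleave p q)).
    by rewrite evens_interleave odds_interleave.
  by exists (interleave q y); rewrite !(evens_interleave, odds_interleave).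
exists (evens y).
suff : B (evens (interleave p (evens y))) (odds (interleave p (evens y))).
  by rewrite evens_interleave odds_interleave.
by apply/BC; exists (odds y).
Qed.

(** The first entry of the witness codes the index, its tail is a witness for that index. *)
Lemma analytic_exists (I : countType) (A : I -> set baire) :
  (forall i, analytic (A i)) -> analytic (fun p => exists i, A i p).
Proof.
move=> /choice [C CP].
pose D o : set baire :=
  if o is Some i then fun r => C i (interleave (evens r) (tail (odds r)))
  else set0.
exists (fun r => D (unpickle (odds r 0)) r); split.
  apply: closed_dep.
    apply: loc_app; apply: loc_eval; [exact: continuous_odds|exact: loc_cst].
  case=> [i|] /=; last exact: closed0.
  apply: closed_preimage (CP i).1; apply: continuous_interleave.
    exact: continuous_evens.
  exact: continuous_compose continuous_tail continuous_odds.
move=> p; split=> [[i /(CP i).2 [y Cy]]|[y]].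
  pose z : baire := fun n => if n is m.+1 then y m else pickle i.
  by exists z; rewrite odds_interleave pickleK /= evens_interleave odds_interleave.
rewrite odds_interleave /D; case: unpickle => //= i.
rewrite evens_interleave odds_interleave => Cy.
by exists i; apply/(CP i).2; exists (tail y).
Qed.

(** Chosen witnesses for all indices are packed into one sequence, by pairing index and position. *)
Lemma analytic_forall (I : countType) (A : I -> set baire) :
  (forall i, analytic (A i)) -> analytic (fun p => forall i, A i p).
Proof.
move=> /choice [C CP].
pose sec (i : I) (y : baire) : baire := fun n => y (pickle (i, n)).
exists (fun r => forall i, C i (interleave (evens r) (sec i (odds r)))); split.
  apply: closed_forall => i; apply: closed_preimage (CP i).1.
  apply: continuous_interleave; first exact: continuous_evens.
  by apply: continuous_compose continuous_odds; exact: continuous_reindex.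
move=> p; split=> [Ap|[y]]; last first.
  rewrite evens_interleave odds_interleave => Cy i.
  by apply/(CP i).2; exists (sec i y).
have /choice [y Cy] := fun i => ((CP i).2 p).1 (Ap i).
pose z : baire := fun k => if unpickle k is Some (i, n) then y i n else 0.
exists z => i; rewrite evens_interleave odds_interleave.
suff -> : sec i z = y i by [].
by apply/funext => n; rewrite /sec /z pickleK.
Qed.

Lemma analytic_and (A B : set baire) :
  analytic A -> analytic B -> analytic (fun p => A p /\ B p).
Proof.
move=> aA aB; apply: (@analytic_ext (fun p => forall b : bool, (if b then A else B) p)).
  move=> p; split=> [H|[Ap Bp] []] //; by split; [exact: (H true)|exact: (H false)].
by apply: analytic_forall => -[].
Qed.

(** The hypothesis is clopen, so its negation is analytic as well. *)
Lemma analytic_imply (A B : set baire) :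
  locally_constant A -> analytic B -> analytic (fun p => A p -> B p).
Proof.
move=> lA aB.
apply: (@analytic_ext (fun p => exists b : bool, (if b then B else (fun r => ~ A r)) p)).
  move=> p; split=> [[[]] //|H].
  by have [/H|] := pselect (A p); [exists true|exists false].
by apply: analytic_exists => -[] //; apply: analytic_loc; exact: loc_app.
Qed.

Lemma analytic_open (A : set baire) :
  (forall p, A p -> exists n, forall p', mkseq p n = mkseq p' n -> A p') ->
  analytic A.
Proof.
move=> oA; apply: (@analytic_ext
    (fun p => exists n, forall p', mkseq p n = mkseq p' n -> A p')).
  by move=> p; split=> [[n]|/oA //]; exact.
apply: analytic_exists => n; apply: analytic_loc.
by apply: (@loc_finite _ _ n) => r r' ->.
Qed.

(** * Finite use: a halting computation reads a finite part of the oracle *)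

Lemma mkseq_le (r r' : nat -> nat) m n :
  m <= n -> mkseq r n = mkseq r' n -> mkseq r m = mkseq r' m.
Proof.
by move=> mn /(congr1 (take m)); rewrite /mkseq -!map_take !take_iota (minn_idPl mn).
Qed.

Lemma eval_use p c v y : eval p c v y ->
  exists n, forall p', mkseq p n = mkseq p' n -> eval p' c v y.
Proof.
elim=> {c v y}.
- by move=> v; exists 0 => p' _; constructor.
- by move=> n v; exists 0 => p' _; constructor.
- by move=> i v iv; exists 0 => p' _; constructor.
- move=> n v; exists n.+1 => p' /(congr1 (nth 0 ^~ n)).
  by rewrite !nth_mkseq // => ->; constructor.
- move=> f gs v w y sw _ IHg _ [nf IHf].
  have [N HN] : exists N, forall i, i < size gs -> forall p', mkseq p N = mkseq p' N ->
      eval p' (nth Zero gs i) v (nth 0 w i).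
    elim: (size gs) IHg => [|k IHk] IHg; first by exists 0.
    have [i ik|N HN] := IHk; first by apply: IHg; exact: ltnW.
    have [M HM] := IHg k (ltnSn k).
    exists (maxn N M) => i; rewrite ltnS leq_eqVlt => /orP [/eqP -> p' E|ik p' E].
      by apply: HM; apply: mkseq_le E; exact: leq_maxr.
    by apply: HN => //; apply: mkseq_le E; exact: leq_maxl.
  exists (maxn nf N) => p' E; apply: (@EvalComp _ f gs v w y) => //.
    by move=> i /HN; apply; apply: mkseq_le E; exact: leq_maxr.
  by apply: IHf; apply: mkseq_le E; exact: leq_maxl.
- by move=> f g v y _ [n IH]; exists n => p' /IH; exact: EvalRec0.
- move=> f g n v z y _ [n1 IH1] _ [n2 IH2]; exists (maxn n1 n2) => p' E.
  have Ez := IH1 p' (mkseq_le (leq_maxl _ _) E).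
  exact: EvalRecS Ez (IH2 p' (mkseq_le (leq_maxr _ _) E)).
- move=> f v n w _ IH1 _ [n2 IH2].
  have [N HN] : exists N, forall m, m < n -> forall p', mkseq p N = mkseq p' N ->
      eval p' f (m :: v) (w m).+1.
    elim: n {IH2} IH1 => [|k IHk] IHg; first by exists 0.
    have [i ik|N HN] := IHk; first by apply: IHg; exact: ltnW.
    have [M HM] := IHg k (ltnSn k).
    exists (maxn N M) => i; rewrite ltnS leq_eqVlt => /orP [/eqP -> p' E|ik p' E].
      by apply: HM; apply: mkseq_le E; exact: leq_maxr.
    by apply: HN => //; apply: mkseq_le E; exact: leq_maxl.
  exists (maxn N n2) => p' E; apply: (@EvalMu _ f v n w).
    by move=> m mn; apply: HN => //; apply: mkseq_le E; exact: leq_maxl.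
  by apply: IH2; apply: mkseq_le E; exact: leq_maxr.
Qed.

Lemma analytic_eval (F : baire -> baire) (k : baire -> nat) c v :
  continuous F -> locally_constant k ->
  analytic (fun r => eval (F r) c v (k r)).
Proof.
move=> cF lk.
apply: (@analytic_ext (fun r => exists y, y = k r /\ eval (F r) c v y)).
  by move=> r; split=> [[y [<-]]|] //; exists (k r).
apply: analytic_exists => y; apply: analytic_and.
  exact: analytic_loc (loc_app (fun z => y = z) lk).
apply: (@analytic_preimage F (fun p => eval p c v y)) => //.
by apply: analytic_open => p; exact: eval_use.
Qed.

(** * Sections of closed sets as trees, and the diagonalization *)

Lemma interleaveK r : interleave (evens r) (odds r) = r.
Proof.
apply/funext => n; rewrite /interleave /evens /odds; have := odd_double_half n.
by case: (odd n) => /= E; rewrite -[in RHS]E.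
Qed.

Lemma mkseqP (r r' : nat -> nat) n :
  mkseq r n = mkseq r' n <-> forall i, i < n -> r i = r' i.
Proof.
split=> [E i i_lt|E]; first by rewrite -(nth_mkseq 0 r i_lt) E nth_mkseq.
by apply: (@eq_from_nth _ 0) => [|i]; rewrite !size_mkseq // => i_lt;
   rewrite !nth_mkseq // E.
Qed.

Lemma size_decode m : size (CodeSeq.decode m) <= m.
Proof.
rewrite -{2}(CodeSeq.decodeK m); elim: (CodeSeq.decode m) => //= n s IH.
apply: (@leq_trans (CodeSeq.code s).*2.+1).
  by rewrite ltnS (leq_trans IH) // -addnn leq_addl.
by rewrite leq_pmull // expn_gt0.
Qed.

Lemma size_le_code s : size s <= CodeSeq.code s.
Proof. by rewrite -{1}(CodeSeq.codeK s) size_decode. Qed.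

Lemma prefix_mkseq (x : nat -> nat) s n :
  prefix s (mkseq x n) -> s = mkseq x (size s).
Proof.
move=> /[dup] /size_prefix; rewrite size_mkseq prefixE => sn /eqP <-.
by rewrite /mkseq -map_take take_iota size_map size_iota (minn_idPl sn).
Qed.

Lemma mkseq_prefix (x : nat -> nat) m n : m <= n -> prefix (mkseq x m) (mkseq x n).
Proof.
by move=> mn; rewrite prefixE size_mkseq /mkseq -map_take take_iota (minn_idPl mn).
Qed.

(** The node [s] is tested against [size s] entries of [p] only; closedness of [C] makes this enough
    in the limit. The root is added by hand, since a tree is nonempty even when the section is
    empty. *)
Definition section_tree (C : set baire) (p : baire) : set (seq nat) :=
  fun s => s = [::] \/ exists r, [/\ C r,
    mkseq (evens r) (size s) = mkseq p (size s) & mkseq (odds r) (size s) = s].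

Definition section_name (C : set baire) (p : baire) : baire :=
  fun m => `[< section_tree C p (CodeSeq.decode m) >].

Lemma section_nameP (C : set baire) p :
  closed C -> tree_name (section_name C p) [set y | C (interleave p y)].
Proof.
move=> cC; exists (section_tree C p); split.
- split; first by exists [::]; left.
  move=> s t st [t0|[r [Cr rp rt]]].
    by move: st; rewrite t0 prefixs0 => /eqP ->; left.
  right; exists r; split=> //; first exact: mkseq_le (size_prefix st) rp.
  by rewrite -rt in st; rewrite -(prefix_mkseq st).
- by move=> s; rewrite /section_name CodeSeq.codeK.
- apply/seteqP; split=> [y Cy|y Cy n].
    apply: (cC (interleave p y)) => U /nbhs_baireP [n nU].
    have [//|[r [Cr]]] := Cy n.+1; rewrite size_mkseq => /mkseqP rp /mkseqP ry.
    exists r; split=> //; apply: nU; apply/cylinderE => i i_lt.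
    rewrite -[r]interleaveK /interleave.
    have i2 : i./2 < n.+1.
      rewrite ltnS (leq_trans (half_leq (ltnW i_lt))) //.
      by rewrite -{2}(doubleK n) half_leq // -addnn leq_addl.
    by case: (odd i); rewrite ?rp ?ry.
  right; exists (interleave p y).
  by rewrite evens_interleave odds_interleave size_mkseq.
Qed.

Lemma section_name_use (C : set baire) p p' n :
  mkseq p n = mkseq p' n -> section_name C p n = section_name C p' n.
Proof.
move=> E; rewrite /section_name; congr (nat_of_bool `[< _ >]); apply/propext.
have Es := mkseq_le (size_decode n) E.
by rewrite /section_tree Es.
Qed.

Lemma continuous_section_name (C : set baire) : continuous (section_name C).
Proof.
apply: continuous_coord => i; apply: (@loc_finite _ _ i) => r r'.
exact: section_name_use.
Qed.

(** Entry [n] of [F p] depends only on entries of [p] below [n], so [p] is defined by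
    course-of-values recursion. *)
Lemma fixed_point (F : baire -> baire) :
  (forall p p' n, mkseq p n = mkseq p' n -> F p n = F p' n) ->
  exists p, F p = p.
Proof.
move=> FE; pose fix l n : seq nat :=
  if n is m.+1 then rcons (l m) (F (nth 0 (l m)) m) else [::].
have sl n : size (l n) = n by elim: n => //= n IH; rewrite size_rcons IH.
pose p : baire := fun n => nth 0 (l n.+1) n.
have lp n : mkseq p n = l n.
  elim: n => //= n IH; rewrite mkseqS IH /p /=.
  by rewrite nth_rcons sl ltnn eqxx.
exists p; apply/funext => n; rewrite {2}/p /= nth_rcons sl ltnn eqxx.
apply: FE; rewrite lp; apply: (@eq_from_nth _ 0); rewrite ?size_mkseq ?sl //.
by move=> i i_lt; rewrite nth_mkseq.
Qed.

(* Whether a sequence belongs to the tree of the section of a closed set at p *)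
(* depends only on earlier values of p, hence the trees that a pair of        *)
(* analytic sets assigns to p can be made the trees named by p itself.        *)
Lemma analytic_diagonal (A B : set baire) : analytic A -> analytic B ->
  exists p X Y, [/\ tree_name (evens p) X, tree_name (odds p) Y,
    A p <-> X !=set0 & B p <-> Y !=set0].
Proof.
move=> [C [cC CA]] [D [cD BD]].
have [p pE] : exists p, interleave (section_name C p) (section_name D p) = p.
  apply: fixed_point => p p' n E; rewrite /interleave.
  have n2 : n./2 <= n by rewrite -{2}(doubleK n) half_leq // -addnn leq_addl.
  by case: (odd n); apply: section_name_use; exact: mkseq_le E.
exists p, [set y | C (interleave p y)], [set y | D (interleave p y)]; split.
- by rewrite -{1}pE evens_interleave; exact: section_nameP.
- by rewrite -{1}pE odds_interleave; exact: section_nameP.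
- exact: CA.
- exact: BD.
Qed.

(** * Paths through trees and perfect subtrees *)

Lemma tree_name_closed p X : tree_name p X -> closed X.
Proof. by move=> [T [_ _ <-]]; exact: closed_paths. Qed.

Lemma nth_prefix (s t : seq nat) i :
  prefix s t -> i < size s -> nth 0 t i = nth 0 s i.
Proof. by move=> /prefixP [u ->] i_lt; rewrite nth_cat i_lt. Qed.

Lemma chain_limit (l : nat -> seq nat) :
  (forall k, prefix (l k) (l k.+1)) -> (forall k, k <= size (l k)) ->
  exists x : baire, forall k, mkseq x (size (l k)) = l k.
Proof.
move=> lS lsize.
have lmono j k : j <= k -> prefix (l j) (l k).
  elim: k => [|k IH]; first by rewrite leqn0 => /eqP ->; exact: prefix_refl.
  rewrite leq_eqVlt => /orP [/eqP -> |]; first exact: prefix_refl.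
  by rewrite ltnS => /IH h; exact: prefix_trans h (lS k).
exists (fun i => nth 0 (l i.+1) i) => k.
apply: (@eq_from_nth _ 0); rewrite ?size_mkseq // => i i_lt.
rewrite nth_mkseq //; have [ki|ik] := leqP k i.+1.
  exact: nth_prefix (lmono _ _ ki) i_lt.
by apply/esym/nth_prefix; [exact: lmono (ltnW ik)|exact: lsize].
Qed.

(** Dependent choice: [T] is a set of good nodes, not necessarily closed under prefixes, and the
    path lies in the surrounding [S]. *)
Lemma path_through (T S : set (seq nat)) :
  (forall s t, prefix s t -> T t -> S s) ->
  (forall s, T s -> exists t, [/\ T t, prefix s t & size s < size t]) ->
  forall s, T s -> exists2 x, paths S x & cylinder s x.
Proof.
move=> TS Text s Ts.
have /choice [f fP] t : exists u, T t -> [/\ T u, prefix t u & size t < size u].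
  by have [/Text [u]|nTt] := pselect (T t); [exists u|exists t].
pose l k := iter k f s.
have Tl k : T (l k) by elim: k => //= k /fP [].
have lS k : prefix (l k) (l k.+1) by case: (fP _ (Tl k)).
have ll k : k <= size (l k).
  by elim: k => // k IH; apply: leq_ltn_trans IH _; case: (fP _ (Tl k)).
have [x xl] := chain_limit lS ll; exists x; last exact: (xl 0).
by move=> n; apply: TS (Tl n); rewrite -xl; exact: mkseq_prefix.
Qed.

Lemma perfect_baireP (P : set baire) : perfect_set P <-> closed P /\
  forall x n, P x -> exists y, [/\ P y, mkseq y n = mkseq x n & y <> x].
Proof.
split=> [[cP lP]|[cP HP]]; split=> //.
  move=> x n; rewrite -{1}lP => /(_ (cylinder (mkseq x n))) [|y [/eqP yx Py]].
    by apply/nbhs_baireP; exists n.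
  by rewrite /cylinder /= size_mkseq => E; exists y.
apply/seteqP; split=> [x lx|x Px U /nbhs_baireP [n nU]].
  by apply: cP => U /lx [y [_ Py Uy]]; exists y.
have [y [Py yx /eqP ne]] := HP x n Px.
by exists y; split=> //; apply: nU; rewrite /cylinder /= size_mkseq.
Qed.

Definition tree_of (p : baire) : set (seq nat) := [set s | p (CodeSeq.code s) = 1].

Lemma loc_tree_of (F : baire -> baire) (k : baire -> seq nat) :
  continuous F -> locally_constant k ->
  locally_constant (fun r => tree_of (F r) (k r)).
Proof.
move=> cF lk; apply: (loc_app (fun v => v = 1)); apply: loc_eval => //.
exact: loc_app.
Qed.

Lemma tree_nameP p X : tree_name p X <->
  [/\ is_tree (tree_of p), forall n, p n <= 1 & paths (tree_of p) = X].
Proof.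
split=> [[T [tT pT <-]]|[tT p1 <-]].
  have -> : tree_of p = T.
    apply/seteqP; split=> s; rewrite /tree_of /= pT; case: asboolP => //.
  by split=> // n; rewrite -(CodeSeq.decodeK n) pT leq_b1.
exists (tree_of p); split=> // s; rewrite /tree_of /=.
by have := p1 (CodeSeq.code s); case: (p _) => [|[]] //= _; case: asboolP.
Qed.

(** All quantifiers range over countable sets, which makes the relation analytic. Splitting above
    every node makes the tree pruned and its set of paths perfect. *)
Definition perfect_subtree (p q : baire) : Prop :=
  is_tree (tree_of q) /\ (forall n, q n <= 1) /\
  (forall s, tree_of q s -> tree_of p s) /\
  (forall s, tree_of q s -> exists ab : seq nat * seq nat,
     [/\ prefix s ab.1, prefix s ab.2, size ab.1 = size ab.2 & ab.1 <> ab.2] /\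
     tree_of q ab.1 /\ tree_of q ab.2).

Lemma analytic_perfect_subtree (F G : baire -> baire) :
  continuous F -> continuous G ->
  analytic (fun r => perfect_subtree (F r) (G r)).
Proof.
move=> cF cG.
have lG s : locally_constant (fun r => tree_of (G r) s).
  by apply: loc_tree_of => //; exact: loc_cst.
have lF s : locally_constant (fun r => tree_of (F r) s).
  by apply: loc_tree_of => //; exact: loc_cst.
apply: analytic_and.
  apply: analytic_and.
    by apply: analytic_exists => s; exact: analytic_loc.
  apply: analytic_forall => s; apply: analytic_forall => t.
  apply: analytic_imply; first exact: loc_cst.
  by apply: analytic_imply => //; exact: analytic_loc.
apply: analytic_and.
  apply: analytic_forall => n; apply: analytic_loc.
  by apply: (loc_app (fun v => is_true (v <= 1))); apply: loc_eval => //; exact: loc_cst.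
apply: analytic_and.
  apply: analytic_forall => s; apply: analytic_imply => //.
  exact: analytic_loc.
apply: analytic_forall => s; apply: analytic_imply => //.
apply: analytic_exists => ab; apply: analytic_and.
  by apply: analytic_loc; exact: loc_cst.
by apply: analytic_and; exact: analytic_loc.
Qed.

Lemma perfect_subtree_name p q : perfect_subtree p q ->
  tree_name q (paths (tree_of q)).
Proof. by move=> [tq [q1 _]]; apply/tree_nameP. Qed.

Lemma perfect_subtree_through p q s : perfect_subtree p q -> tree_of q s ->
  exists2 x, paths (tree_of q) x & cylinder s x.
Proof.
move=> [[_ qpre] [_ [_ qsplit]]]; apply: path_through => // {}s qs.
have [[a b] /= [[sa sb sab ab] [qa qb]]] := qsplit _ qs.
exists a; split=> //; rewrite ltn_neqAle size_prefix // andbT.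
apply/negP => /eqP E; apply: ab.
have -> : a = s by apply/eqP; move: sa; rewrite prefixE E take_size.
by apply/eqP; move: sb; rewrite prefixE E sab take_size eq_sym.
Qed.

Lemma perfect_subtree_paths p q : perfect_subtree p q ->
  [/\ paths (tree_of q) !=set0, perfect_set (paths (tree_of q)) &
      paths (tree_of q) `<=` paths (tree_of p)].
Proof.
move=> pq; have [[[s0 q0] qpre] [_ [qp qsplit]]] := pq; split.
- by have [x] := perfect_subtree_through pq q0; exists x.
- apply/perfect_baireP; split; first exact: closed_paths.
  move=> x n /(_ n) /qsplit [[a b] /= [[na nb sab ab] [qa qb]]].
  (* Two distinct nodes of equal length cannot both lie on [x]; a path through one that does not is
     the required second point. *)
  have [c [nc qc cx]] : exists c,
      [/\ prefix (mkseq x n) c, tree_of q c & c <> mkseq x (size c)].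
    have [ax|ax] := pselect (a = mkseq x (size a)); last by exists a.
    by exists b; split=> //; rewrite -sab -ax => ba; exact: ab.
  have [y qy yc] := perfect_subtree_through pq qc; exists y; split=> //.
    move: nc; rewrite -yc => /prefix_mkseq ->; rewrite size_mkseq //.
  by move=> yx; apply: cx; rewrite -yx yc.
- by move=> x qx n; exact: qp.
Qed.

Lemma perfect_subtree_exists p P : perfect_set P -> P !=set0 ->
  P `<=` paths (tree_of p) ->
  exists2 q, perfect_subtree p q & forall x n, P x -> tree_of q (mkseq x n).
Proof.
move=> /perfect_baireP [_ Psplit] [x0 Px0] Pp.
pose R s := exists2 x, P x & cylinder s x.
pose q : baire := fun n => `[< R (CodeSeq.decode n) >].
have qR s : tree_of q s <-> R s.
  by rewrite /tree_of /q /= CodeSeq.codeK; case: asboolP.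
have Rmk x n : P x -> R (mkseq x n) by exists x => //; exact: cylinder_self.
exists q; last by move=> x n Px; apply/qR; exact: Rmk.
split; [split|split; [|split]].
- by exists (mkseq x0 0); apply/qR; exact: Rmk.
- move=> s t st /qR [x Px xt]; apply/qR.
  by move: st; rewrite -xt => /prefix_mkseq ->; exact: Rmk.
- by move=> n; exact: leq_b1.
- by move=> s /qR [x /Pp + <-]; exact.
- move=> s /qR [x Px xs]; have [y [Py yx ne]] := Psplit x (size s) Px.
  have [m m_ne] : exists m, y m <> x m.
    by apply/existsNP => E; apply: ne; apply/funext.
  pose n := maxn (size s) m.+1.
  exists (mkseq x n, mkseq y n) => /=; split; last by split; apply/qR; exact: Rmk.
  split; rewrite ?size_mkseq //.
  + by rewrite -xs; apply: mkseq_prefix; exact: leq_maxl.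
  + by rewrite -xs -yx; apply: mkseq_prefix; exact: leq_maxl.
  + by move/mkseqP/(_ m) => E; apply: m_ne; rewrite E // leq_max ltnSn orbT.
Qed.

(** * Fans, and why [PK] reduces neither to [PST] nor to [C_Baire] *)

(* The zero sequence lies in the perfect kernel of [fan X] if and only if [X] *)
(* is nonempty: the coordinates [n + 2 i + 2], which the condition leaves     *)
(* free, keep the nonzero points from being isolated.                         *)
Definition fan (X : set baire) : set baire :=
  [set y | forall n, (forall i, i < n -> y i = 0) -> y n <> 0 ->
     X (fun i => y (n + i.*2.+1))].

(** The graph of [fan] on names: being closed, it lets [section_name] turn a name of [X]
    continuously into one of [fan X]. *)
Definition fan_rel : set baire :=
  [set r | forall n, (forall i, i < n -> odds r i = 0) -> odds r n <> 0 ->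
     forall k, tree_of (evens r) (mkseq (fun i => odds r (n + i.*2.+1)) k)].

Lemma loc_imply (A B : set baire) : locally_constant A -> locally_constant B ->
  locally_constant (fun r => A r -> B r).
Proof. exact: (loc_app2 (fun P Q : Prop => P -> Q)). Qed.

Lemma loc_zero_prefix (F : baire -> baire) n : continuous F ->
  locally_constant (fun r => forall i, i < n -> F r i = 0).
Proof.
move=> cF r; apply: filterS (loc_mkseq n cF r) => r' /= /mkseqP E.
by apply/propext; split=> H i i_lt; move: (H i i_lt); rewrite E.
Qed.

Lemma closed_fan_rel : closed fan_rel.
Proof.
have cO := continuous_odds.
have lO i : locally_constant (fun r => odds r i).
  by apply: loc_eval => //; exact: loc_cst.
apply: closed_forall => n.
suff -> : (fun r => (forall i, i < n -> odds r i = 0) -> odds r n <> 0 -> forall k,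
    tree_of (evens r) (mkseq (fun i => odds r (n + i.*2.+1)) k)) =
  (fun r => forall k, (forall i, i < n -> odds r i = 0) -> odds r n <> 0 ->
    tree_of (evens r) (mkseq (fun i => odds r (n + i.*2.+1)) k)).
  apply: closed_forall => k; apply: closed_loc.
  apply: loc_imply; first exact: loc_zero_prefix.
  apply: loc_imply; first exact: (loc_app (fun v => v <> 0)).
  apply: loc_tree_of; first exact: continuous_evens.
  apply: (@loc_mkseq (fun r i => odds r (n + i.*2.+1))).
  by apply: continuous_coord => i; exact: lO.
apply/funext => r; apply/propext; split=> H; last by move=> n0 nn k; exact: H.
by move=> k n0 nn; exact: H.
Qed.

Lemma fan_name p X : tree_name p X -> tree_name (section_name fan_rel p) (fan X).
Proof.
move=> /tree_nameP [_ _ <-]; have := section_nameP p closed_fan_rel.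
congr tree_name; apply/seteqP; split=> y /=;
  by rewrite /fan_rel /= evens_interleave odds_interleave.
Qed.

Lemma fan_zero X : fan X (fun=> 0).
Proof. by move=> n _ []. Qed.

Lemma fan_set0 : fan set0 `<=` [set (fun=> 0) : baire].
Proof.
move=> y y0 /=; apply/funext => n.
elim/ltn_ind: n => n IH; apply: contrapT => yn.
exact: (y0 n IH yn).
Qed.

Lemma perfect_fan X : closed (fan X) -> X !=set0 -> perfect_set (fan X).
Proof.
move=> cX [x Xx]; apply/perfect_baireP; split=> // y n fy.
have [y0|/existsNP [a ya]] := pselect (forall i, y i = 0).
  (* After [n] zeros and a 1, the member [x] of [X] is written at the odd offsets from [n]. *)
  pose z : baire := fun i => if i < n then 0 else
    if i == n then 1 else x (i - n).-1./2.
  have zn : z n = 1 by rewrite /z ltnn eqxx.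
  exists z; split.
  - move=> m m0 zm; suff -> : m = n.
      suff -> : (fun i => z (n + i.*2.+1)) = x by [].
      apply/funext => i; rewrite /z ltnNge leq_addr /=.
      by rewrite -[X in _ == X]addn0 eqn_add2l addKn /= doubleK.
    case: (ltngtP m n) => // [mn|nm]; first by move: zm; rewrite /z mn.
    by have := m0 n nm; rewrite zn.
  - by apply/mkseqP => i i_lt; rewrite /z i_lt y0.
  - by move=> zy; move: zn; rewrite zy y0.
have [k [ky k0]] : exists k, y k <> 0 /\ forall i, i < k -> y i = 0.
  have ex : exists m, y m != 0 by exists a; apply/eqP.
  case: (ex_minnP ex) => k /eqP yk kmin; exists k; split=> // i ik.
  by apply/eqP; apply: contraTT ik => /kmin; rewrite -leqNgt.
(* A position beyond [n] at an even offset from the first nonzero entry [k], hence free to be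
   changed. *)
pose j := k + n.+1.*2.
pose z : baire := fun i => if i == j then (y j).+1 else y i.
have kj : k < j by rewrite -[k]addn0 ltn_add2l.
have nj : n < j by apply: ltn_addl; rewrite doubleS -addnn !ltnS (leq_trans (leq_addl n n)).
have zE i : i < j -> z i = y i by rewrite /z; case: ltngtP.
exists z; split.
- move=> m m0 zm; have mk : m = k.
    case: (ltngtP m k) => // [mk|km].
      by move: zm; rewrite zE ?k0 // (ltn_trans mk).
    by have := m0 k km; rewrite zE.
  rewrite mk; suff -> : (fun i => z (k + i.*2.+1)) = (fun i => y (k + i.*2.+1)).
    exact: fy.
  apply/funext => i; rewrite /z /j eqn_add2l.
  by case: eqP => // /(congr1 odd); rewrite /= !odd_double.
- by apply/mkseqP => i i_lt; rewrite zE // (ltn_trans i_lt).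
- move=> /(congr1 (@^~ j)); rewrite /z eqxx => /esym/eqP.
  by rewrite -[X in X == _]addn0 -addn1 eqn_add2l.
Qed.

Lemma PK_set0_zero (A P : closed_set) :
  set_of_closed A = fan set0 -> PK A P -> ~ set_of_closed P (fun=> 0).
Proof.
move=> AE [/perfect_baireP [_ Psplit] PA _] /(Psplit _ 0) [y [/PA + _]].
by rewrite AE => /fan_set0 /= ->.
Qed.

Lemma PK_fan (X : set baire) (A P : closed_set) : X !=set0 ->
  set_of_closed A = fan X -> PK A P -> set_of_closed P (fun=> 0).
Proof.
move=> X0 AE kP.
have kA : perfect_kernel A A.
  split=> //; last by rewrite setDv.
  by rewrite AE; apply: perfect_fan => //; rewrite -AE; exact: closed_set_closed.
by rewrite -(perfect_kernel_unique kA kP) AE; exact: fan_zero.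
Qed.

(* Such a reduction would make emptiness of [X] an analytic property of names *)
(* of [X]: some solution of the instance obtained from [fan X] gives a kernel *)
(* name that omits an initial segment of the zero sequence.                   *)
Lemma PK_not_le (W : repr_space) (g : problem closed_space W)
    (Sol : baire -> baire -> Prop) :
  (forall F G, continuous F -> continuous G -> analytic (fun r => Sol (F r) (G r))) ->
  (forall p z, name p z -> dom g z -> exists q, Sol p q) ->
  (forall p z q, name p z -> dom g z -> Sol p q -> exists2 w, name q w & g z w) ->
  ~ weihrauch_le PK g.
Proof.
move=> aSol exSol solP [Phi [Psi [[cPhi PhiP] [cPsi PsiP] red]]].
pose t := section_name fan_rel.
pose A p := exists p' q : baire, (forall n, eval (t p) cPhi [:: n] (p' n)) /\
  Sol p' q /\
  exists n, eval (interleave (t p) q) cPsi [:: CodeSeq.code (mkseq (fun=> 0) n)] 0.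
have aA : analytic A.
  have [ce co] := (continuous_evens, continuous_odds).
  have ct : continuous t := @continuous_section_name _.
  apply: analytic_ex; apply: analytic_ex => /=.
  apply: analytic_and; last (apply: analytic_and; last apply: analytic_exists => n).
  - apply: analytic_forall => n; apply: analytic_eval.
      by apply: (continuous_compose ct); exact: continuous_compose.
    apply: (@loc_eval (fun r => odds (evens r))); last exact: loc_cst.
    exact: continuous_compose.
  - by apply: aSol => //; exact: (continuous_compose co ce).
  - apply: analytic_eval; last exact: loc_cst.
    apply: continuous_interleave => //; apply: (continuous_compose ct).
    exact: continuous_compose.
(* [A] is evaluated at [evens p], which names [X]: thus [X] is nonempty iff [A] holds of its own
   name. *)
have [p [X [_ [pX _ AX _]]]] :=
  analytic_diagonal (analytic_preimage continuous_evens aA) aA.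
have tX := fan_name pX; rewrite -/t in tX.
pose a := ClosedSet (tree_name_closed tX).
have doma : dom PK a by rewrite dom_PK.
have [p' [z [Phip' p'z domz sol]]] := red _ a tX doma.
have Sol_kernel q : Sol p' q -> exists r (P : closed_set),
    [/\ Psi (interleave (t (evens p)) q) = Some r, tree_name r P & PK a P].
  by move=> /(solP _ _ _ p'z domz) [w qw gzw]; exact: sol qw gzw.
have [X0|nX0] := pselect (X !=set0).
  have [p'' [q [p''E [Solq [n evn]]]]] := AX.2 X0.
  have p''p' : p'' = p' by apply/funext => i; exact: eval_fun (p''E i) (PhiP _ _ Phip' i).
  rewrite p''p' in Solq; have [r [P [Psir rP kP]]] := Sol_kernel _ Solq.
  have /tree_nameP [_ _ PE] := rP.
  have : paths (tree_of r) (fun=> 0) by rewrite PE; exact: (@PK_fan X a P).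
  move=> /(_ n); rewrite /tree_of /= => r1.
  by have := eval_fun evn (PsiP _ _ Psir _); rewrite r1.
apply: (nX0); apply/AX.
have [q Solq] := exSol _ _ p'z domz.
have [r [P [Psir rP kP]]] := Sol_kernel _ Solq.
have /tree_nameP [_ r1 PE] := rP.
have X0 : X = set0 by apply/eqP; apply: contra_notT nX0 => /set0P.
have aE : set_of_closed a = fan set0 by rewrite -X0.
have := PK_set0_zero aE kP; rewrite -PE => /existsNP [n rn].
exists p', q; split; first by move=> i; exact: PhiP.
split=> //; exists n; have := PsiP _ _ Psir (CodeSeq.code (mkseq (fun=> 0) n)).
move: rn (r1 (CodeSeq.code (mkseq (fun=> 0) n))); rewrite /tree_of /=.
by case: (r _) => [|[]].
Qed.

Lemma PK_not_le_PST : ~ weihrauch_le PK PST.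
Proof.
apply: (@PK_not_le _ _ perfect_subtree).
- exact: analytic_perfect_subtree.
- move=> p z /tree_nameP [_ _ pz] [P [_ [P0 pP PA]]].
  by have [|q] := perfect_subtree_exists pP P0 (p := p); [rewrite pz|exists q].
- move=> p z q /tree_nameP [_ _ pz] [_ [uz _]] pq.
  exists (ClosedSet (@closed_paths (tree_of q))); first exact: perfect_subtree_name pq.
  have [q0 perfq qp] := perfect_subtree_paths pq.
  by split=> //; split=> //=; rewrite -pz.
Qed.

Lemma PK_not_le_C_Baire : ~ weihrauch_le PK C_Baire.
Proof.
apply: (@PK_not_le _ _ (fun p q => forall n, tree_of p (mkseq q n))).
- move=> F G cF cG; apply: analytic_forall => n; apply: analytic_loc.
  by apply: loc_tree_of => //; exact: loc_mkseq.
- move=> p z /tree_nameP [_ _ pz] [x]; rewrite /C_Baire -pz; by exists x.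
- move=> p z q /tree_nameP [_ _ pz] _ pq; exists q => //.
  by rewrite /C_Baire -pz.
Qed.

(** * The positive reduction *)

Lemma PST_le_PK : weihrauch_le PST PK.
Proof.
exists Some, (fun r => Some (odds r)); split.
- by exists Oracle => p _ [<-] n; constructor.
(* Computes [n.*2.+1], where the interleaving stores entry [n] of the kernel name; [Proj 1] is the
   previous value of the recursion. *)
- pose odd_code := Rec (Comp Succ [:: Zero]) (Comp Succ [:: Comp Succ [:: Proj 1]]).
  have odd_codeP p n : eval p odd_code [:: n] n.*2.+1.
    elim: n => [|n IH].
      apply: EvalRec0; apply: (@EvalComp _ _ _ _ [:: 0]) => //; last by constructor.
      by case=> // _; constructor.
    apply: (EvalRecS IH).
    apply: (@EvalComp _ _ _ _ [:: n.*2.+2]) => //; last by constructor.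
    case=> // _; apply: (@EvalComp _ _ _ _ [:: n.*2.+1]) => //; last by constructor.
    by case=> // _; exact: (@EvalProj _ 1).
  exists (Comp Oracle [:: odd_code]) => p _ [<-] n.
  apply: (@EvalComp _ _ _ _ [:: n.*2.+1]) => //; last exact: EvalOracle.
  by case.
- move=> p x px [_ [ux _]]; exists p, x; split=> //; first by rewrite dom_PK.
  move=> q P qP kP; exists q, P; split=> //; first by rewrite odds_interleave.
  have [pP Px cxP] := kP; split=> //; split=> //.
  apply/set0P/eqP => P0; apply: ux; move: cxP; by rewrite P0 setD0.
Qed.

(** * Comparing trees by embeddings *)

(* [y] codes a map on sequences that preserves lengths and prefixes: its value *)
(* at the code of [s] is the last entry of the image of [s].                   *)
Definition lift_seq (y : baire) (s : seq nat) : seq nat :=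
  mkseq (fun i => y (CodeSeq.code (take i.+1 s))) (size s).

Lemma size_lift_seq y s : size (lift_seq y s) = size s.
Proof. exact: size_mkseq. Qed.

Lemma prefix_lift_seq y s t : prefix s t -> prefix (lift_seq y s) (lift_seq y t).
Proof.
move=> /prefixP [u ->]; rewrite /lift_seq size_cat.
suff -> : mkseq (fun i => y (CodeSeq.code (take i.+1 s))) (size s) =
    mkseq (fun i => y (CodeSeq.code (take i.+1 (s ++ u)))) (size s).
  by apply: mkseq_prefix; exact: leq_addr.
by apply/mkseqP => i i_lt; rewrite takel_cat.
Qed.

(** For well-founded trees, this compares the rank of [S] at [a] with that of [S'] at [b]. With
    roots [[::]] and [[:: n]] the inequality of the ranks of the trees becomes strict. *)
Definition embeds (S S' : set (seq nat)) (a b : seq nat) : Prop :=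
  exists y, forall s, S (a ++ s) -> S' (b ++ lift_seq y s).

Lemma embeds_children (S S' : set (seq nat)) a b :
  (forall s t, prefix s t -> S t -> S s) -> S' b ->
  (forall n, S (rcons a n) -> exists m, embeds S S' (rcons a n) (rcons b m)) ->
  embeds S S' a b.
Proof.
move=> Spre S'b H.
have /choice [f fP] n : exists my : nat * baire, S (rcons a n) ->
    forall s, S (rcons a n ++ s) -> S' (rcons b my.1 ++ lift_seq my.2 s).
  have [/H [m [y E]]|nS] := pselect (S (rcons a n)); first by exists (m, y).
  by exists (0, fun=> 0).
(* A one-entry sequence goes to the chosen child, a longer one is left to that child's embedding;
   [lift_seq] never consults the empty sequence. *)
pose y : baire := fun k => if CodeSeq.decode k is n :: s then
  if s is [::] then (f n).1 else (f n).2 (CodeSeq.code s) else 0.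
exists y => -[|n s] Ss; first by rewrite cats0.
suff -> : lift_seq y (n :: s) = (f n).1 :: lift_seq (f n).2 s.
  rewrite -cat_rcons; apply: fP; last by rewrite cat_rcons.
  by apply: Spre Ss; rewrite -cat_rcons; exact: prefix_prefix.
apply: (@eq_from_nth _ 0); first by rewrite size_lift_seq /= size_lift_seq.
rewrite size_lift_seq => -[|i] i_lt.
  by rewrite nth_mkseq // /y CodeSeq.codeK /= take0.
rewrite nth_mkseq // [RHS](nth_mkseq 0) // /y CodeSeq.codeK.
by case: s i_lt {Ss}.
Qed.

(* Think of two players alternately descending in [S] and [S']: if neither    *)
(* embedding exists, both trees contain the play in which nobody gets stuck.  *)
Lemma embeds_total (S S' : set (seq nat)) : is_tree S -> is_tree S' ->
  embeds S S' [::] [::] \/ exists n, embeds S' S [::] [:: n].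
Proof.
move=> [_ Spre] [[s' S's'] S'pre]; apply: contrapT => /not_orP [nSS' /forallNP nS'S].
have S'0 : S' [::] := S'pre [::] s' (prefix0s s') S's'.
(* The positions, with [S] to move, from which the play can be continued. *)
pose inv a b := [/\ S' b, ~ embeds S S' a b & forall n, ~ embeds S' S b (rcons a n)].
have step b : (exists a, inv a b) ->
    exists c, [/\ exists a, inv a c, prefix b c & size b < size c].
  move=> [a [S'b nab nba]].
  have [n [San nanb]] : exists n, S (rcons a n) /\
      forall m, ~ embeds S S' (rcons a n) (rcons b m).
    apply: contrapT => /forallNP H; apply: nab; apply: embeds_children => // n San.
    apply: contrapT => /forallNP Hn; apply: (H n); split=> //.
  have [m [S'bm nbm]] : exists m, S' (rcons b m) /\
      forall k, ~ embeds S' S (rcons b m) (rcons (rcons a n) k).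
    apply: contrapT => /forallNP H; apply: (nba n); apply: embeds_children => // m S'bm.
    by apply: contrapT => /forallNP Hm; apply: (H m); split.
  exists (rcons b m); rewrite prefix_rcons size_rcons; split=> //.
  by exists (rcons a n).
have invS' s t : prefix s t -> (exists a, inv a t) -> S' s.
  by move=> st [a [S't _ _]]; exact: S'pre st S't.
have [|x S'x _] := path_through invS' step (s := [::]); first by exists [::].
(* Once [S'] has a path [x], any tree embeds in it by sending [s] to the initial segment of [x] of
   the same length. *)
apply: nSS'; exists (fun k => x (size (CodeSeq.decode k)).-1) => s _ /=.
suff -> : lift_seq (fun k => x (size (CodeSeq.decode k)).-1) s = mkseq x (size s).
  exact: S'x.
by apply/mkseqP => i i_lt; rewrite CodeSeq.codeK size_takel.
Qed.

Lemma embeds_path (S S' : set (seq nat)) b :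
  (forall s t, prefix s t -> S' t -> S' s) ->
  embeds S S' [::] b -> paths S !=set0 -> paths S' !=set0.
Proof.
move=> S'pre [y yE] [x Sx].
pose l k := b ++ lift_seq y (mkseq x k).
have [|k|z zl] := @chain_limit l.
- move=> k; rewrite /l prefix_catr // eqxx; apply: prefix_lift_seq; exact: mkseq_prefix.
- by rewrite size_cat size_lift_seq size_mkseq leq_addl.
exists z => n; apply: (S'pre _ (l n)); last exact/yE/Sx.
by rewrite -zl; apply: mkseq_prefix; rewrite size_cat size_lift_seq size_mkseq leq_addl.
Qed.

(** The composite maps [S] to itself, preserves prefixes and adds one to the length, so iterating it
    from the root builds a path. *)
Lemma embeds_cycle (S S' : set (seq nat)) n : is_tree S ->
  embeds S S' [::] [::] -> embeds S' S [::] [:: n] -> paths S !=set0.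
Proof.
move=> [[s0 Ss0] Spre] [y yE] [z zE].
pose phi s := n :: lift_seq z (lift_seq y s).
pose T s := S s /\ prefix s (phi s).
have TS s t : prefix s t -> T t -> S s by move=> st [St _]; exact: Spre st St.
have Text s : T s -> exists t, [/\ T t, prefix s t & size s < size t].
  move=> [Ss sphi]; exists (phi s); split=> //; last by rewrite /= !size_lift_seq.
  split; first by apply: zE; exact: (yE s).
  by rewrite {1 2}/phi prefix_cons eqxx; do 2!apply: prefix_lift_seq.
have [|x Sx _] := path_through TS Text (s := [::]); last by exists x.
by split=> //; exact: Spre (prefix0s s0) Ss0.
Qed.

(** The even half of [r] codes two trees, the odd half an answer. First entry 0 announces an
    embedding of the first tree in the second, [n.+1] one of the second in the first below
    [[:: n]]. *)
Definition compare_rel : set baire :=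
  [set r | if odds r 0 is n.+1
    then forall s, tree_of (odds (evens r)) s ->
      tree_of (evens (evens r)) (n :: lift_seq (tail (odds r)) s)
    else forall s, tree_of (evens (evens r)) s ->
      tree_of (odds (evens r)) (lift_seq (tail (odds r)) s)].

Lemma closed_compare_rel : closed compare_rel.
Proof.
have [ce co] := (continuous_evens, continuous_odds).
have cee := continuous_compose ce ce; have coe := continuous_compose co ce.
have lh s : locally_constant (fun r => lift_seq (tail (odds r)) s).
  apply: (@loc_mkseq (fun r i => tail (odds r) (CodeSeq.code (take i.+1 s)))).
  apply: (@continuous_compose (fun r i => r (CodeSeq.code (take i.+1 s)))
    (fun r => tail (odds r))).
    exact: continuous_reindex.
  exact: continuous_compose continuous_tail co.
pose D k : set baire := if k is n.+1
    then fun r => forall s, tree_of (odds (evens r)) s ->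
      tree_of (evens (evens r)) (n :: lift_seq (tail (odds r)) s)
    else fun r => forall s, tree_of (evens (evens r)) s ->
      tree_of (odds (evens r)) (lift_seq (tail (odds r)) s).
suff : closed (fun r => D (odds r 0) r).
  by congr closed; apply/funext => r; rewrite /compare_rel /D /=; case: (odds r 0).
apply: closed_dep; first by apply: loc_eval => //; exact: loc_cst.
case=> [|n] /=; apply: closed_forall => s; apply: closed_loc; apply: loc_imply;
  apply: loc_tree_of => //; try exact: loc_cst.
exact: (loc_app (cons n)).
Qed.

(** * Names of the kernel with a given prefix, and why [C_Baire] does not reduce to [PK] *)

Lemma perfect_sub_kernel (A P Q : set baire) :
  perfect_kernel A P -> perfect_set Q -> Q `<=` A -> Q `<=` P.
Proof.
move=> kP /perfect_baireP [cQ Qsplit] QA x Qx.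
have [/perfect_baireP [cP Psplit] PA cAP] := kP.
suff kPQ : perfect_kernel A (P `|` Q).
  by rewrite (perfect_kernel_unique kP kPQ); right.
split; last 1 first.
- apply: sub_countable cAP; apply: subset_card_le => y [Ay nPQ].
  by split=> // Py; apply: nPQ; left.
- apply/perfect_baireP; split; first exact: closedU.
  move=> y n [/(Psplit y n)|/(Qsplit y n)] [z [? ? ?]]; exists z; split=> //.
    by left.
  by right.
- by move=> y [/PA|/QA].
Qed.

(** Keep the nodes of [r] with code below [m] and their prefixes, and add all initial segments of
    points of [P]. The kept nodes are shorter than [m], or of length at most their code, so they add
    no path. *)
Lemma tree_name_modify (P : set baire) r X m : closed P -> tree_name r X ->
  (forall x n, P x -> CodeSeq.code (mkseq x n) < m ->
     r (CodeSeq.code (mkseq x n)) <> 0) ->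
  exists2 q, tree_name q P & mkseq q m = mkseq r m.
Proof.
move=> cP /tree_nameP [[[s0 rs0] rpre] r1 _] rP.
have r0 : tree_of r [::] := rpre _ _ (prefix0s s0) rs0.
pose T s := [\/ s = [::], exists2 x, P x & cylinder s x |
  exists t, [/\ prefix s t, CodeSeq.code t < m & tree_of r t]].
have rT s : CodeSeq.code s < m -> T s <-> tree_of r s.
  move=> sm; split=> [[-> //|[x Px xs]|[t [st _ /rpre]]]|rs]; [|exact|].
    move: sm; rewrite -xs => /rP - /(_ Px); rewrite /tree_of /=.
    by have := r1 (CodeSeq.code (mkseq x (size s))); case: (r _) => [|[]].
  by apply: Or33; exists s; rewrite prefix_refl.
exists (fun n => `[< T (CodeSeq.decode n) >]).
  exists T; split.
  - split; first by exists [::]; exact: Or31.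
    move=> s t st [t0|[x Px xt]|[u [tu um ru]]].
    + by move: st; rewrite t0 prefixs0 => /eqP ->; exact: Or31.
    + apply: Or32; exists x => //; move: st; rewrite -xt => /prefix_mkseq ->.
      exact: cylinder_self.
    + by apply: Or33; exists u; split=> //; exact: prefix_trans st tu.
  - by move=> s; rewrite CodeSeq.codeK.
  - apply/seteqP; split=> [x Tx|x Px n]; last first.
      by apply: Or32; exists x => //; exact: cylinder_self.
    apply: cP => U /nbhs_baireP [n nU].
    have [|[y Py]|[t [st tm _]]] := Tx (maxn n m.+1).
    + move=> /(congr1 size); rewrite size_mkseq /= => E.
      by move: (leq_maxr n m.+1); rewrite E.
    + rewrite /cylinder /= size_mkseq => yx; exists y; split=> //; apply: nU.
      by rewrite /cylinder /= size_mkseq; apply: mkseq_le yx; exact: leq_maxl.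
    + have := leq_trans (size_prefix st) (size_le_code t); rewrite size_mkseq.
      by rewrite geq_max => /andP [_ /ltn_trans /(_ tm)]; rewrite ltnn.
apply/mkseqP => i i_lt; have := rT (CodeSeq.decode i).
rewrite CodeSeq.decodeK /tree_of /= CodeSeq.decodeK => /(_ i_lt) E.
have := r1 i; case: asboolP => [/E -> //|nT].
by case Ei : (r i) => [|[|//]] // _; case: nT; apply/E.
Qed.

Lemma continuous_const (q : baire) : continuous (fun _ : baire => q).
Proof. by apply: continuous_coord => i; exact: loc_cst. Qed.

Lemma mkseq_interleave (p q q' : baire) n :
  mkseq q n = mkseq q' n ->
  mkseq (interleave p q) n.*2 = mkseq (interleave p q') n.*2.
Proof.
move=> /mkseqP E; apply/mkseqP => i i_lt; rewrite /interleave; case: (odd i) => //.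
by apply: E; rewrite ltn_half_double.
Qed.

Lemma compare_rel_nonempty p X Y :
  tree_name (evens p) X -> tree_name (odds p) Y ->
  exists y, compare_rel (interleave p y).
Proof.
move=> /tree_nameP [tX _ _] /tree_nameP [tY _ _].
have [[y yE]|[n [y yE]]] := embeds_total tX tY.
  pose z : baire := fun n => if n is m.+1 then y m else 0.
  by exists z; rewrite /compare_rel /= odds_interleave evens_interleave.
pose z : baire := fun k => if k is m.+1 then y m else n.+1.
by exists z; rewrite /compare_rel /= odds_interleave evens_interleave.
Qed.

(* [N b p] says that no name of the perfect kernel makes the reduction answer *)
(* with direction [b].  It is analytic because a prefix [tau] of a tree name  *)
(* fails to continue to a kernel name iff some sequence that it excludes lies *)
(* on a perfect subtree.  Diagonalizing makes each tree well-founded exactly  *)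
(* when its direction can be chosen.  Some direction is chosen, so one tree,  *)
(* and by the embedding the other too, is well-founded; then both directions  *)
(* can be chosen, which bounds each rank by the other, once strictly.         *)
Lemma C_Baire_not_le_PK : ~ weihrauch_le C_Baire PK.
Proof.
move=> [Phi [Psi [[cPhi PhiP] [cPsi PsiP] red]]].
pose t := section_name compare_rel.
have ct : continuous t := @continuous_section_name _.
have [ce co] := (continuous_evens, continuous_odds).
pose extendible tau := exists r X, tree_name r X /\ mkseq r (size tau) = tau.
pose forces (b : bool) (tau : seq nat) (u : seq nat) := exists v, (v == 0) = b /\
  forall o, mkseq o (size tau).*2 = u -> eval o cPsi [:: 0] v.
(* [tau] is continued by zeros, but the cut at twice its length hides this. *)
pose oracle p (tau : seq nat) : seq nat :=
  mkseq (interleave (t p) (nth 0 tau : baire)) (size tau).*2.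
pose N b p := exists p' : baire, (forall n, eval (t p) cPhi [:: n] (p' n)) /\
  forall tau, extendible tau -> forces b tau (oracle p tau) ->
  exists s, (CodeSeq.code s < size tau /\ nth 0 tau (CodeSeq.code s) = 0) /\
    exists q, perfect_subtree p' q /\ tree_of q s.
have aN b : analytic (N b).
  apply: analytic_ex => /=; apply: analytic_and.
    apply: analytic_forall => n; apply: analytic_eval.
      exact: continuous_compose.
    by apply: loc_eval => //; exact: loc_cst.
  apply: analytic_forall => tau; apply: analytic_imply; first exact: loc_cst.
  apply: analytic_imply.
    apply: (loc_app (forces b tau)); apply: loc_mkseq.
    apply: continuous_interleave; last exact: continuous_const.
    exact: continuous_compose.
  apply: analytic_exists => s; apply: analytic_and.
    by apply: analytic_loc; exact: loc_cst.
  apply: analytic_ex => /=; apply: analytic_and.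
    by apply: analytic_perfect_subtree => //; exact: continuous_compose.
  by apply: analytic_loc; apply: loc_tree_of => //; exact: loc_cst.
have [p [X [Y [pX pY NX NY]]]] := analytic_diagonal (aN false) (aN true).
have tp := section_nameP p closed_compare_rel; rewrite -/(t p) in tp.
pose a := ClosedSet (tree_name_closed tp).
have [p' [z [Phip' p'z _ sol]]] := red _ a tp (compare_rel_nonempty pX pY).
have /tree_nameP [_ _ zE] := p'z.
have [P kP] := perfect_kernel_exists (@closed_set_closed z).
have [pP Pz _] := kP; have [cP _] := pP.
have {}sol q : tree_name q P -> exists2 y : baire,
    eval (interleave (t p) q) cPsi [:: 0] (y 0) & compare_rel (interleave p y).
  move=> qP; have [r [y [Psir ry ay]]] := sol q (ClosedSet cP) qP kP.
  by exists y => //; rewrite -ry; exact: PsiP Psir 0.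
(* If [N b] fails, some prefix forcing [b] excludes no segment of a kernel point, so
   [tree_name_modify] continues it to a kernel name. *)
have chosen b : ~ N b p ->
    exists2 y : baire, (y 0 == 0) = b & compare_rel (interleave p y).
  move=> nN; have [tau [[r [Z [rZ rtau]]] [v [vb ev]] ntau]] : exists tau,
      [/\ extendible tau, forces b tau (oracle p tau) & ~ exists s,
        (CodeSeq.code s < size tau /\ nth 0 tau (CodeSeq.code s) = 0) /\
        exists q, perfect_subtree p' q /\ tree_of q s].
    apply: contrapT => H; apply: nN; exists p'; split; first by move=> n; exact: PhiP.
    by move=> tau etau ftau; apply: contrapT => K; apply: H; exists tau.
  have [|q qP qtau] := tree_name_modify (m := size tau) cP rZ.
    move=> x n Px xn r0; apply: ntau; exists (mkseq x n); split.
      by split=> //; rewrite -rtau nth_mkseq.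
    have [| |q pq qx] := perfect_subtree_exists (p := p') pP; first by exists x.
      by rewrite zE.
    by exists q; split=> //; exact: qx.
  have [y evy cy] := sol q qP; exists y => //.
  rewrite -vb (eval_fun evy (ev _ _)) //; apply: mkseq_interleave.
  rewrite qtau rtau; apply: (@eq_from_nth _ 0); rewrite ?size_mkseq // => i i_lt.
  by rewrite nth_mkseq.
(* Any kernel name [q] gets some answer, forced by a finite prefix; [N] for that answer would make
   [q] exclude a segment of a kernel point. *)
have notboth : ~ (N false p /\ N true p).
  have [q qP] := tree_name_surjective (ClosedSet cP).
  have [y evy _] := sol q qP; have [n nuse] := eval_use evy.
  have qtau : mkseq q n = mkseq (nth 0 (mkseq q n)) n.
    by apply/mkseqP => i i_lt; rewrite nth_mkseq.
  suff : ~ N (y 0 == 0) p by case: (y 0 == 0) => H [].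
  move=> [p'' [p''E H]].
  have p''p' : p'' = p' by apply/funext => i; exact: eval_fun (p''E i) (PhiP _ _ Phip' i).
  have [||s [[]]] := H (mkseq q n).
  - by exists q, P; rewrite size_mkseq.
  - exists (y 0); split=> // o; rewrite /oracle size_mkseq -(mkseq_interleave _ qtau) => E.
    by apply: nuse; apply/esym; apply: mkseq_le E; rewrite -addnn leq_addl.
  rewrite size_mkseq => sn; rewrite nth_mkseq // => qs0 [k [pk ks]].
  have [x kx xs] := perfect_subtree_through pk ks.
  have [_ perfk kp] := perfect_subtree_paths pk.
  have Px : P x.
    by apply: (perfect_sub_kernel kP perfk) kx; rewrite -zE -p''p'.
  have /tree_nameP [_ _ /= qE] := qP; rewrite -qE in Px.
  by have := Px (size s); rewrite /tree_of /= xs qs0.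
have /tree_nameP [tX _ XE] := pX; have /tree_nameP [tY _ YE] := pY.
have first_embeds : ~ N true p -> embeds (tree_of (evens p)) (tree_of (odds p)) [::] [::].
  move=> /chosen [y /eqP y0]; rewrite /compare_rel /= evens_interleave odds_interleave y0.
  by exists (tail y).
have second_embeds : ~ N false p ->
    exists n, embeds (tree_of (odds p)) (tree_of (evens p)) [::] [:: n].
  move=> /chosen [y]; rewrite /compare_rel /= evens_interleave odds_interleave.
  by case: (y 0) => // n _ yE; exists n, (tail y).
have imp1 : ~ N true p -> ~ N false p.
  move=> nN /NX X0; apply: (nN); apply/NY; rewrite -YE; rewrite -XE in X0.
  exact: embeds_path tY.2 (first_embeds nN) X0.
have imp2 : ~ N false p -> ~ N true p.
  move=> nN /NY Y0; apply: (nN); apply/NX; rewrite -XE; rewrite -YE in Y0.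
  have [n En] := second_embeds nN.
  exact: embeds_path tX.2 En Y0.
have nF : ~ N false p by move=> F; apply: notboth; split=> //; apply: contrapT => /imp1.
have [n En] := second_embeds nF.
by apply: (nF); apply/NX; rewrite -XE; exact: embeds_cycle (first_embeds (imp2 nF)) En.
Qed.

Theorem proposition4p12 :
  weihrauch_lt PST PK /\ weihrauch_incomparable PK C_Baire.
Proof.
split; split.
- exact: PST_le_PK.
- exact: PK_not_le_PST.
- exact: PK_not_le_C_Baire.
- exact: C_Baire_not_le_PK.
Qed.
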